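(* Let $K$ be a field and $c\ge 1$ an integer. Let $\mathbf{M}$ be a finitely generated graded $\mathrm{OI}$-module over $(\mathbf{X}^{\mathrm{OI},1})^{\otimes c}$ or a finitely generated graded $\mathrm{FI}$-module over $(\mathbf{X}^{\mathrm{FI},1})^{\otimes c}$. If $j$ is any fixed integer, then $\dim_K [\mathbf{M}_n]_j$ is given by a polynomial in $n$ with rational coefficients whenever $n$ is sufficiently large. More precisely, there are integers $a_1,\ldots,a_D$ (depending on $j$) such that, for all sufficiently large $n$, \[ \dim_K [\mathbf{M}_n]_j = a_D \binom{n+D-1}{D-1} + \cdots + a_2 \binom{n+1}{1} + a_1, \] where $a_D > 0$ unless $[\mathbf{M}_n]_j = 0$ for all sufficiently large $n$.
   Context: $\mathrm{OI}$ (resp. $\mathrm{FI}$) is the category with objects $[n] = \{1,\dots,n\}$, $n \ge 0$ ($[0]=\emptyset$), and morphisms the strictly increasing (resp. injective) maps $\varepsilon\colon [m]\to[n]$. The $\mathrm{OI}$-algebra $(\mathbf{X}^{\mathrm{OI},1})^{\otimes c}$ (resp. $\mathrm{FI}$-algebra $(\mathbf{X}^{\mathrm{FI},1})^{\otimes c}$) over $K$ is the functor $\mathbf{P}$ from $\mathrm{OI}$ (resp. $\mathrm{FI}$) to commutative $K$-algebras with $\mathbf{P}_n = K[x_{i,j} : 1\le i\le c,\ 1\le j\le n]$ (so $\mathbf{P}_0=K$) and, for $\varepsilon\colon[m]\to[n]$, $\varepsilon_*\colon \mathbf{P}_m\to\mathbf{P}_n$ the $K$-algebra homomorphism with $\varepsilon_*(x_{i,j})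 = x_{i,\varepsilon(j)}$. Every variable has degree one. An $\mathrm{OI}$-module (resp. $\mathrm{FI}$-module) $\mathbf{M}$ over $\mathbf{P}$ is a functor from $\mathrm{OI}$ (resp. $\mathrm{FI}$) to $K$-vector spaces such that each $\mathbf{M}_n = \mathbf{M}([n])$ is a $\mathbf{P}_n$-module and $\mathbf{M}(\varepsilon)(aq) = \varepsilon_*(a)\,\mathbf{M}(\varepsilon)(q)$ for all $\varepsilon\colon[m]\to[n]$, $a\in\mathbf{P}_m$, $q\in\mathbf{M}_m$. It is graded if every $\mathbf{M}_n$ is a $\mathbb{Z}$-graded $\mathbf{P}_n$-module and every $\mathbf{M}(\varepsilon)$ is homogeneous of degree $0$. It is finitely generated if there is a finite subset of $\coprod_n \mathbf{M}_n$ not contained in any proper submodule (subfunctor compatible with the module structures). $[\mathbf{M}_n]_j$ is the degree $j$ component of $\mathbf{M}_n$. *)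

(* Defs.v *)
From HB Require Import structures.
From mathcomp Require Import all_boot all_order all_algebra.
From mathcomp Require Import mpoly.

Set Implicit Arguments.
Unset Strict Implicit.
Unset Printing Implicit Defensive.

Import GRing.Theory.
Local Open Scope ring_scope.

Inductive index_category := OI | FI.

(* The object [n] is encoded by 'I_n, i.e. {0, ..., n-1}. *)
Definition is_mor (C : index_category) (m n : nat) (f : {ffun 'I_m -> 'I_n}) :
    bool :=
  match C with
  | OI => [forall i : 'I_m, forall j : 'I_m, (i < j)%N ==> (f i < f j)%N]
  | FI => injectiveb f
  end.

Record mor (C : index_category) (m n : nat) := Mor {
  mor_fun :> {ffun 'I_m -> 'I_n};
  morP : is_mor C mor_fun
}.

Lemma is_mor_id (C : index_category) (n : nat) :
  is_mor C [ffun i : 'I_n => i].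
Proof.
case: C => /=.
  by apply/forallP => i; apply/forallP => j; apply/implyP; rewrite !ffunE.
by apply/injectiveP => i j; rewrite !ffunE.
Qed.

Definition mor_id (C : index_category) (n : nat) : mor C n n :=
  Mor (is_mor_id C n).

Lemma is_mor_comp (C : index_category) (m n p : nat)
    (g : mor C n p) (f : mor C m n) :
  is_mor C [ffun i : 'I_m => g (f i)].
Proof.
case: C g f => [] [g gP] [f fP] /=; rewrite /= in gP fP.
  apply/forallP => i; apply/forallP => j; apply/implyP => ij; rewrite !ffunE.
  move/forallP/(_ (f i))/forallP/(_ (f j))/implyP: gP; apply.
  by move/forallP/(_ i)/forallP/(_ j)/implyP: fP; apply.
by apply/injectiveP => i j; rewrite !ffunE => /(injectiveP _ gP)/(injectiveP _ fP).
Qed.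

Definition mor_comp (C : index_category) (m n p : nat)
    (g : mor C n p) (f : mor C m n) : mor C m p :=
  Mor (is_mor_comp g f).

(* The polynomial ring K[x_{i,j} : i < c, j < n]: the c * n variables are
   numbered by the bijection [mxvec_index] from 'I_c * 'I_n to 'I_(c * n). *)
Notation Palg K c n := {mpoly K[c * n]}.

Definition xvar (K : fieldType) (c n : nat) (i : 'I_c) (j : 'I_n) : Palg K c n :=
  'X_(mxvec_index i j).

(* The K-algebra map P_m -> P_n induced by f, see [Pmap_xvar] below.  The
   matrix (x_{i, f j})_{i, j} is flattened by [mxvec] to provide the images of
   the c * m variables. *)
Definition Pmap (K : fieldType) (c : nat) (C : index_category) (m n : nat)
    (f : mor C m n) (p : Palg K c m) : Palg K c n :=
  p \mPo [tuple mxvec (\matrix_(i < c, j < m) xvar K i (f j)) 0 k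
         | k < c * m].

Lemma Pmap_xvar (K : fieldType) (c : nat) (C : index_category) (m n : nat)
    (f : mor C m n) (i : 'I_c) (j : 'I_m) :
  Pmap f (xvar K i j) = xvar K i (f j).
Proof.
by rewrite /Pmap /xvar comp_mpolyXU -tnth_nth tnth_mktuple mxvecE mxE.
Qed.

Lemma Pmap_const (K : fieldType) (c : nat) (C : index_category) (m n : nat)
    (f : mor C m n) (a : K) :
  Pmap f (a%:MP : Palg K c m) = a%:MP.
Proof. exact: comp_mpolyC. Qed.

(* The K-vector space structure of M_n is the restriction of its P_n-module
   structure to the constants; the maps [act f] are then K-linear by
   [Pmap_const] and [act_semilinear]. *)
Record Pmodule (C : index_category) (K : fieldType) (c : nat) := MkPmodule {
  carrier :> forall n : nat, lmodType (Palg K c n);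
  act : forall m n : nat, mor C m n -> {additive carrier m -> carrier n};
  act_id : forall (n : nat) (q : carrier n), act (mor_id C n) q = q;
  act_comp : forall (m n p : nat) (g : mor C n p) (f : mor C m n)
    (q : carrier m), act (mor_comp g f) q = act g (act f q);
  act_semilinear : forall (m n : nat) (f : mor C m n) (a : Palg K c m)
    (q : carrier m), act f (a *: q) = Pmap f a *: act f q
}.

Unset Implicit Arguments.

(* [hcomp n j q] means that q lies in the degree j component of M_n.  The
   components are K-subspaces: closure under scalars is the case d = 0 of
   [hcomp_scale]. *)
Record grading (C : index_category) (K : fieldType) (c : nat)
    (M : Pmodule C K c) := MkGrading {
  hcomp : forall (n : nat) (j : int), M n -> Prop;
  hcomp0 : forall (n : nat) (j : int), hcomp n j (0 : M n);
  hcompD : forall (n : nat) (j : int) (u v : M n),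
    hcomp n j u -> hcomp n j v -> hcomp n j (u + v);
  hcomp_scale : forall (n d : nat) (j : int) (a : Palg K c n) (q : M n),
    a \is d.-homog -> hcomp n j q -> hcomp n (d%:Z + j) (a *: q);
  hcomp_span : forall (n : nat) (q : M n),
    exists (s : seq int) (h : int -> M n),
      (forall j : int, hcomp n j (h j)) /\ q = \sum_(j <- s) h j;
  hcomp_direct : forall (n : nat) (s : seq int) (h : int -> M n),
    uniq s -> (forall j : int, hcomp n j (h j)) -> \sum_(j <- s) h j = 0 ->
    forall j : int, j \in s -> h j = 0;
  act_hcomp : forall (m n : nat) (f : mor C m n) (j : int) (q : M m),
    hcomp m j q -> hcomp n j (act M f q)
}.

Set Implicit Arguments.
Arguments grading {C K c} M.
Arguments hcomp {C K c M} g n j _.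
Arguments hcomp0 {C K c M} g n j.
Arguments hcompD {C K c M} g {n j u v} _ _.
Arguments hcomp_scale {C K c M} g {n d j a q} _ _.
Arguments hcomp_span {C K c M} g {n} q.
Arguments hcomp_direct {C K c M} g {n s h} _ _ _ {j} _.
Arguments act_hcomp {C K c M} g {m n} f {j q} _.

Record is_submodule (C : index_category) (K : fieldType) (c : nat)
    (M : Pmodule C K c) (N : forall n : nat, M n -> Prop) : Prop :=
  MkSubmodule {
  submod0 : forall n : nat, N n 0;
  submodD : forall (n : nat) (u v : M n), N n u -> N n v -> N n (u + v);
  submodZ : forall (n : nat) (a : Palg K c n) (q : M n), N n q -> N n (a *: q);
  submod_act : forall (m n : nat) (f : mor C m n) (q : M m),
    N m q -> N n (act M f q)
}.

Definition finitely_generated (C : index_category) (K : fieldType) (c : nat)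
    (M : Pmodule C K c) : Prop :=
  exists (r : nat) (w : 'I_r -> nat) (g : forall i : 'I_r, M (w i)),
    forall N : forall n : nat, M n -> Prop,
      is_submodule N -> (forall i : 'I_r, N (w i) (g i)) ->
      forall (n : nat) (q : M n), N n q.

(* The K-subspace A of the K[x_1, ..., x_n]-module V has dimension d over K:
   it has a K-basis with d elements. *)
Definition has_dim (K : fieldType) (n : nat) (V : lmodType {mpoly K[n]})
    (A : V -> Prop) (d : nat) : Prop :=
  exists b : 'I_d -> V,
    [/\ forall i : 'I_d, A (b i),
        forall v : V, A v ->
          exists a : 'I_d -> K, v = \sum_(i < d) (a i)%:MP *: b i
      & forall a : 'I_d -> K, \sum_(i < d) (a i)%:MP *: b i = 0 ->
          forall i : 'I_d, a i = 0].

(* Main.v *)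
From HB Require Import structures.
Require Import Defs.
From mathcomp Require Import all_boot all_order all_algebra.
From mathcomp Require Import mpoly.
From mathcomp Require Import boolp zify ring.

(** Fix the degree [j].  A homogeneous element of [M n] of degree [j] is a sum
    of terms [a *: (x *: act M f g)] with [a] constant, [x] a product of
    variables and [g] one of finitely many homogeneous generators.  The degree
    bounds the number of factors of [x], hence the number of points of [n] that
    are in the image of [f] or index a factor of [x].  So there is one [W],
    independent of [n], such that all these points lie in the image of a
    strictly increasing map from [W] points as soon as [W <= n], and the term
    is the image under that map of one of finitely many elements of [M W].
    This holds for injections as well as for increasing maps; from here on only
    increasing maps matter, and the degree [j] part of [M n] is spanned over
    [K] by the images of a finite list of elements of degree [j] of [M W] under
    all of them ([term_kspan], [wvecs_hcomp]).

    The increasing maps from [W] points to [n] points are the bit words of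
    length [n] with [W] ones, and composing with the map that omits one point
    inserts a zero.  As in Groebner basis theory, order words
    lexicographically and call a word bad if its vector depends linearly on
    smaller ones; the other words give a basis ([has_dim_words]).  Inserting a
    zero at a fixed place is compatible with the order and is induced by a
    linear map, so the bad words form an ideal, that is, a set stable under
    insertion of zeros ([evpoly_wvecs]).

    It remains to count the words outside an ideal ([evpoly_cocount]).  Words
    with [w] ones correspond to [w.+1] gap lengths, so ideals are in effect
    monomial ideals in [w.+1] variables, and the count is a Hilbert function.
    Splitting words according to their first letter yields a recursion, which
    is solved by means of the ascending chain condition
    ([ideal_noetherian]).

    Eventually polynomial functions are handled as functions with an eventually
    vanishing iterated difference; integration of differences produces integer
    coefficients in the basis of binomials ([evdeg_binomial]), and dimensions
    being nonnegative makes the top coefficient positive ([binsum_lead]). *)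

Set Implicit Arguments.
Unset Strict Implicit.
Unset Printing Implicit Defensive.

Import Order.TTheory GRing.Theory Num.Theory.
Local Open Scope ring_scope.

(** * Eventually polynomial integer sequences *)

Definition nabla (f : nat -> int) (n : nat) : int := f n - f n.-1.

(** Eventual polynomials of degree less than [d] are encoded by the eventual
    vanishing of the [d]-th backward difference: this makes closure under
    antidifferences definitional.  The binomial form is recovered in
    [evdeg_binomial]. *)
Fixpoint evdeg (d : nat) (f : nat -> int) : Prop :=
  if d is d'.+1 then evdeg d' (nabla f)
  else exists n0, forall n, (n0 <= n)%N -> f n = 0.

Definition evpoly (f : nat -> int) : Prop := exists d, evdeg d f.

Lemma evdeg_ext d f g n0 :
  (forall n, (n0 <= n)%N -> f n = g n) -> evdeg d f -> evdeg d g.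
Proof.
elim: d f g n0 => [|d IHd] f g n0 fg /=.
  by case=> n1 f0; exists (maxn n0 n1) => n nn; rewrite -fg ?f0 //; lia.
apply: (IHd _ _ n0.+1) => n nn.
by rewrite /nabla !fg //; lia.
Qed.

Lemma evdegS d f : evdeg d f -> evdeg d.+1 f.
Proof.
elim: d f => [|d IHd] f /=; last exact: IHd.
case=> n0 f0; exists n0.+1 => n nn.
by rewrite /nabla !f0 ?subrr //; lia.
Qed.

Lemma evdeg_leq d e f : (d <= e)%N -> evdeg d f -> evdeg e f.
Proof.
move/subnK<-; elim: (e - d)%N => [|k IHk] // fd.
by rewrite addSn; apply/evdegS/IHk.
Qed.

Lemma evdegD d f g : evdeg d f -> evdeg d g -> evdeg d (fun n => f n + g n).
Proof.
elim: d f g => [|d IHd] f g /=.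
  case=> n0 f0 [n1 g0]; exists (maxn n0 n1) => n nn.
  by rewrite f0 ?g0 ?addr0 //; lia.
move=> fd gd; apply: (evdeg_ext (n0 := 0)) (IHd _ _ fd gd) => n _.
by rewrite /nabla; ring.
Qed.

Lemma evdeg_pred d f : evdeg d f -> evdeg d (fun n => f n.-1).
Proof.
elim: d f => [|d IHd] f /=; last exact: IHd.
by case=> n0 f0; exists n0.+1 => n nn; apply: f0; lia.
Qed.

Lemma evpoly0 : evpoly (fun=> 0).
Proof. by exists 0%N, 0%N. Qed.

Lemma evpolyD f g : evpoly f -> evpoly g -> evpoly (fun n => f n + g n).
Proof.
case=> d fd [e ge]; exists (maxn d e).
by apply: evdegD; [move: fd | move: ge]; apply: evdeg_leq; lia.
Qed.

Lemma evpoly_shift f g : (forall n, f n.+1 = g n) -> evpoly g -> evpoly f.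
Proof.
move=> fg [d gd]; exists d; move/evdeg_pred: gd.
by apply: (evdeg_ext (n0 := 1)) => -[|n] // _; rewrite fg.
Qed.

Lemma evpoly_antidiff f g :
  (forall n, f n.+1 = f n + g n) -> evpoly g -> evpoly f.
Proof.
move=> fg [d gd]; exists d.+1; move/evdeg_pred: gd.
by apply: (evdeg_ext (n0 := 1)) => -[|n] // _; rewrite /nabla fg /=; ring.
Qed.

Definition binsum (d : nat) (a : nat -> int) (n : nat) : int :=
  \sum_(i < d) a i * ('C(n + i, i))%:Z.

Lemma binsum_nabla d a n :
  binsum d.+1 a n.+1 - binsum d.+1 a n = binsum d (a \o succn) n.+1.
Proof.
rewrite /binsum !big_ord_recl /= !bin0 opprD addrACA subrr add0r -sumrB.
apply: eq_bigr => i _; rewrite -mulrBr; congr (_ * _).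
by rewrite /bump /= !add1n !addSn !addnS binS PoszD; ring.
Qed.

(** Backward differences lower by one the index of the binomials
    ['C(n + i, i)], so a sum for [nabla f] is integrated by shifting its
    coefficients; only a constant remains to be added. *)
Lemma evdeg_binomial d f :
  evdeg d f -> exists a n0, forall n, (n0 <= n)%N -> f n = binsum d a n.
Proof.
elim: d f => [|d IHd] f /=.
  by case=> n0 f0; exists (fun=> 0), n0 => n /f0 ->; rewrite /binsum big_ord0.
case/IHd=> b [n0 fb].
pose a0 k i : int := if i is i'.+1 then b i' else k.
(* The constant coefficient is chosen so that both sides agree at n0. *)
exists (a0 (f n0 - binsum d.+1 (a0 0) n0)), n0 => n /subnK <-.
elim: (n - n0)%N => [|k IHk].
  by rewrite add0n /binsum !big_ord_recl /= mul0r !bin0 mulr1; ring.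
set a := a0 _ in IHk *; have Ea := binsum_nabla d a (k + n0).
have Ef : f (k + n0).+1 - f (k + n0)%N = binsum d (a \o succn) (k + n0).+1.
  by apply: fb; lia.
by rewrite addSn -[LHS](subrK (f (k + n0)%N)) Ef -Ea IHk subrK.
Qed.

(** The difference is a binomial sum with the same top coefficient, so by
    induction it is eventually at least one. *)
Lemma binsum_pos d a :
  0 < a d -> exists n0, forall n, (n0 <= n)%N -> 0 < binsum d.+1 a n.
Proof.
elim: d a => [|d IHd] a ad.
  by exists 0%N => n _; rewrite /binsum big_ord1 bin0 mulr1.
have [n0 pos] := IHd (a \o succn) ad.
have grow k : binsum d.+2 a n0 + k%:Z <= binsum d.+2 a (k + n0).
  elim: k => [|k IHk]; first by rewrite add0n addr0.
  have := binsum_nabla d.+1 a (k + n0).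
  have := pos (k + n0).+1 (leqW (leq_addl _ _)).
  rewrite addSn gtz0_ge1 => p E.
  rewrite -[leRHS](subrK (binsum d.+2 a (k + n0))) E.
  by rewrite intS addrCA lerD.
exists (`|binsum d.+2 a n0|.+1 + n0)%N => n nn.
have := grow (n - n0)%N; rewrite subnK; by lia.
Qed.

Fixpoint binpoly (i : nat) : {poly rat} :=
  if i is i'.+1 then
    (i'.+1%:R)^-1 *: (binpoly i' * ('X + (i'.+1%:R)%:P))
  else 1.

Lemma binpolyE i n : (binpoly i).[n%:R] = ('C(n + i, i))%:R.
Proof.
elim: i => [|i IHi] /=; first by rewrite hornerC bin0.
rewrite hornerZ hornerM hornerD hornerX hornerC IHi -natrD.
apply: (@mulfI _ (i.+1%:R)); first by rewrite pnatr_eq0.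
rewrite mulVKf ?pnatr_eq0 // -!natrM addnS.
by rewrite -mul_bin_diag mulnC.
Qed.

Lemma binsum_poly d a :
  exists p : {poly rat}, forall n, p.[n%:R] = (binsum d a n)%:~R.
Proof.
exists (\sum_(i < d) (a i)%:~R *: binpoly i) => n.
rewrite horner_sum rmorph_sum /=; apply: eq_bigr => i _.
by rewrite hornerZ binpolyE rmorphM.
Qed.

(** * Ideals of bit words *)

(** The enumeration is decreasing for the lexicographic order, see
    [pairwise_words]. *)
Fixpoint bitwords (n : nat) : seq bitseq :=
  if n is n'.+1
  then map (cons true) (bitwords n') ++ map (cons false) (bitwords n')
  else [:: [::]].

(** Bit words of length [n] with [w] ones encode the [w]-subsets of [n]
    points, that is, the strictly increasing maps from [w] points to [n]. *)
Definition words (n w : nat) : seq bitseq :=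
  [seq u <- bitwords n | count id u == w].

Lemma mem_bitwords n u : (u \in bitwords n) = (size u == n).
Proof.
elim: n u => [|n IHn] u /=; first by rewrite inE; case: u.
rewrite mem_cat; case: u => [|[] u] /=.
- by apply/orP=> -[]/mapP[].
- rewrite mem_map ?IHn ?eqSS; last by move=> ? ? [].
  by rewrite orbC; case: mapP => [[]|].
- rewrite orbC mem_map ?IHn ?eqSS; last by move=> ? ? [].
  by rewrite orbC; case: mapP => [[]|].
Qed.

Lemma mem_words n w u :
  (u \in words n w) = (size u == n) && (count id u == w).
Proof. by rewrite mem_filter mem_bitwords andbC. Qed.

(** Inserting a zero in a word amounts to composing the corresponding map with
    an increasing injection that omits one point. *)
Definition is_ideal (I : pred bitseq) : Prop :=
  forall a b, I (a ++ b) -> I (a ++ false :: b).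

Lemma is_ideal_cat I a : is_ideal I -> is_ideal (fun u => I (a ++ u)).
Proof. by move=> idI b c; rewrite !catA; apply: idI. Qed.

(** The ascending chain condition for the predicates in the class [cls],
    compared on [P] only: words with a fixed number of ones are a subset of the
    type on which ideals live. *)
Definition noetherian (T : Type) (P : pred T) (cls : pred T -> Prop) : Prop :=
  forall c : nat -> pred T, (forall s, cls (c s)) ->
    (forall s x, c s x -> c s.+1 x) ->
    exists S, forall s x, (S <= s)%N -> P x -> c s x -> c S x.

Lemma chain_leq (T : Type) (c : nat -> pred T) :
  (forall s x, c s x -> c s.+1 x) ->
  forall s t x, (s <= t)%N -> c s x -> c t x.
Proof.
move=> cS s t x /subnK<-; elim: (t - s)%N => // k IHk /IHk.
by rewrite addSn; apply: cS.
Qed.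

(** The diagonal of a doubly indexed ascending family stabilises, say at [S0],
    which settles all the rows of index at least [S0]; the finitely many
    remaining rows stabilise one by one. *)
Lemma noetherian_double (T : Type) (P : pred T) (cls : pred T -> Prop)
    (Q : nat -> nat -> pred T) :
  noetherian P cls -> (forall s t, cls (Q s t)) ->
  (forall s t x, Q s t x -> Q s.+1 t x) ->
  (forall s t x, Q s t x -> Q s t.+1 x) ->
  exists S, forall s t x, (S <= s)%N -> P x -> Q s t x -> Q S t x.
Proof.
move=> noeP clsQ Qs Qt.
have Qs' t := chain_leq (fun s => Qs s t); have Qt' s := chain_leq (Qt s).
have [S0 stab0] := noeP (fun s => Q s s) (fun s => clsQ s s)
  (fun s x q => Qs _ _ _ (Qt _ _ _ q)).
have [S1 stab1] : exists S, forall t, (t < S0)%N ->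
    forall s x, (S <= s)%N -> P x -> Q s t x -> Q S t x.
  elim: S0 {stab0} => [|k [S IHk]]; first by exists 0%N.
  have [S' stab'] := noeP (fun s => Q s k) (fun s => clsQ s k)
    (fun s x => Qs s k x).
  exists (maxn S S') => t; rewrite ltnS leq_eqVlt => /orP[/eqP->|tk] s x.
    rewrite geq_max => /andP[_ S's] Px /(stab' _ _ S's Px).
    by apply: Qs'; rewrite leq_maxr.
  rewrite geq_max => /andP[Ss _] Px /(IHk _ tk _ _ Ss Px).
  by apply: Qs'; rewrite leq_maxl.
exists (maxn S0 S1) => s t x; rewrite geq_max => /andP[S0s S1s] Px Qx.
have [tS0|S0t] := ltnP t S0.
  by apply: Qs' (stab1 _ tS0 _ _ S1s Px Qx); rewrite leq_maxr.
have: Q (maxn s t) (maxn s t) x.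
  by apply: Qs' (leq_maxl _ _) _; apply: Qt' (leq_maxr _ _) _.
move/(stab0 _ _ (leq_trans S0s (leq_maxl _ _)) Px).
by move/(Qt' _ _ _ _ S0t); apply: Qs'; rewrite leq_maxl.
Qed.

Lemma noetherian_point : noetherian (pred1 [::] : pred bitseq) (fun=> True).
Proof.
move=> c _ cS; have [[s cs]|ncs] := pselect (exists s, c s [::]).
  by exists s => t x _ /eqP->.
by exists 0%N => s x _ /eqP-> cs; case: ncs; exists s.
Qed.

Lemma count0_nseq u : count id u = 0%N -> u = nseq (size u) false.
Proof. by elim: u => //= -[] //= u IHu /IHu {1}->. Qed.

Lemma countS_nseq w u : count id u = w.+1 ->
  exists t v, u = nseq t false ++ true :: v /\ count id v = w.
Proof.
elim: u => // -[] u IHu /=; first by case=> <-; exists 0%N, u.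
by case/IHu=> t [v [-> <-]]; exists t.+1, v.
Qed.

(** A word with [w.+1] ones is cut after its first one: an ideal becomes a
    sequence of ideals on words with [w] ones, indexed by the position of the
    first one, and this sequence is ascending. *)
Lemma ideal_noetherian w :
  noetherian (fun u : bitseq => count id u == w) is_ideal.
Proof.
elim: w => [|w IHw] I idI IS.
  pose Q s t (_ : bitseq) := I s (nseq t false).
  have [|||S stab] := noetherian_double (Q := Q) noetherian_point.
  - by [].
  - by move=> s t x; apply: IS.
  - by move=> s t x; apply: (idI _ [::]).
  exists S => s u Ss /eqP/count0_nseq->.
  by apply: (stab s (size u) [::] Ss); rewrite inE.
pose Q s t u := I s (nseq t false ++ true :: u).
have [|||S stab] := noetherian_double (Q := Q) IHw.
- move=> s t a b; have := is_ideal_cat (a := rcons (nseq t false) true) (idI s).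
  by move/(_ a b); rewrite !cat_rcons.
- by move=> s t x; apply: IS.
- by move=> s t x; apply: (idI _ [::]).
exists S => s u Ss /eqP/countS_nseq[t [v [-> cv]]].
by apply: stab => //; apply/eqP.
Qed.

Definition cocount (I : pred bitseq) (n w : nat) : nat :=
  count (predC I) (words n w).

Lemma cocountS I n w :
  cocount I n.+1 w =
  (cocount (I \o cons false) n w +
   if w is w'.+1 then cocount (I \o cons true) n w' else 0)%N.
Proof.
rewrite /cocount /words /= filter_cat count_cat addnC !filter_map !count_map.
congr addn; case: w => [|w]; last by congr count; apply: eq_filter.
by rewrite (@eq_filter _ _ pred0) ?filter_pred0 // => u.
Qed.

(** By [cocountS], the numbers for [I] and for [I \o cons false] differ by a
    sequence that is eventually polynomial.  Iterating [cons false] gives an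
    ascending chain of ideals; where it stabilises, [cocountS] exhibits an
    antidifference, and the earlier members follow by descending the chain. *)
Lemma evpoly_cocount_rec w I :
  (forall J, is_ideal J ->
     evpoly (fun n =>
       (if w is w'.+1 then cocount (J \o cons true) n w' else 0%N)%:Z)) ->
  is_ideal I -> evpoly (fun n => (cocount I n w)%:Z).
Proof.
move=> evT idI; pose J t : pred bitseq := fun u => I (nseq t false ++ u).
have idJ t : is_ideal (J t) by apply: is_ideal_cat.
have JS t u : J t u -> J t.+1 u by apply: (idI [::]).
have Jf t : J t \o cons false =1 J t.+1.
  by move=> u; rewrite /J -addn1 nseqD -catA.
have recJ t n : (cocount (J t) n.+1 w)%:Z = (cocount (J t.+1) n w)%:Z +
    (if w is w'.+1 then cocount (J t \o cons true) n w' else 0%N)%:Z.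
  rewrite cocountS PoszD; congr (Posz _ + _).
  by apply: eq_count => u /=; rewrite -Jf.
have [T stab] := ideal_noetherian w idJ JS.
have evJT : evpoly (fun n => (cocount (J T) n w)%:Z).
  apply: evpoly_antidiff (evT _ (idJ T)) => n; rewrite recJ; congr (Posz _ + _).
  apply: eq_in_count => u; rewrite mem_words /= => /andP[_ cu]; congr negb.
  by apply/idP/idP; [apply: stab | apply: JS].
suff: forall t, evpoly (fun n => (cocount (J t) n w)%:Z) -> 
    evpoly (fun n => (cocount I n w)%:Z) by apply; apply: evJT.
elim=> // t IHt evt; apply: IHt.
exact: evpoly_shift (recJ t) (evpolyD evt (evT _ (idJ t))).
Qed.

Lemma evpoly_cocount w I :
  is_ideal I -> evpoly (fun n => (cocount I n w)%:Z).
Proof.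
elim: w I => [|w IHw] I; apply: evpoly_cocount_rec => J idJ.
  exact: evpoly0.
by apply: IHw; apply: (is_ideal_cat (a := [:: true])).
Qed.

(** The lexicographic order, with [false] below [true]; only words of the same
    length are compared. *)
Fixpoint ltw (u v : bitseq) : bool :=
  match u, v with
  | a :: u', b :: v' => ~~ a && b || (a == b) && ltw u' v'
  | _, _ => false
  end.

Lemma ltw_irr u : ltw u u = false.
Proof. by elim: u => //= a u ->; case: a. Qed.

Lemma ltw_asym u v : ltw u v -> ltw v u = false.
Proof. by elim: u v => [|a u IHu] [|b v] //=; case: a b => [] [] //= /IHu. Qed.

Lemma pairwise_words n w : pairwise (fun u v => ltw v u) (words n w).
Proof.
apply: subseq_pairwise (filter_subseq _ _) _.
elim: n => //= n IHn; rewrite pairwise_cat !pairwise_map; apply/and3P; split.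
- by apply/allrelP => u v /mapP[u' _ ->] /mapP[v' _ ->].
- exact: IHn.
- exact: IHn.
Qed.

Lemma ltw_insert a b a' b' : size a = size a' ->
  ltw (a ++ b) (a' ++ b') -> ltw (a ++ false :: b) (a' ++ false :: b').
Proof.
elim: a a' => [|x a IHa] [|x' a'] //= [] /IHa lt /orP[->//|/andP[-> /lt->]].
by rewrite orbT.
Qed.

(** * Spans and dimensions over the constants *)

(** Scalars are the constants [K] of the polynomial ring.  Peeling off one
    vector at a time makes [has_dim_cons] the step of every induction on
    lists. *)
Fixpoint kspan (K : fieldType) (N : nat) (V : lmodType {mpoly K[N]})
    (s : seq V) (v : V) : Prop :=
  if s is x :: s' then exists a : K, kspan s' (v - a%:MP *: x) else v = 0.

Section Span.

Variables (K : fieldType) (N : nat) (V : lmodType {mpoly K[N]}).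
Implicit Types (s : seq V) (u v x : V) (A B : V -> Prop).

Lemma kspan0 s : kspan s 0.
Proof.
by elim: s => //= x s IHs; exists 0; rewrite mpolyC0 scale0r subr0.
Qed.

Lemma kspanD s u v : kspan s u -> kspan s v -> kspan s (u + v).
Proof.
elim: s u v => [|x s IHs] u v /=; first by move=> -> ->; rewrite addr0.
case=> a su [b sv]; exists (a + b).
by rewrite mpolyCD scalerDl opprD addrACA; apply: IHs.
Qed.

Lemma kspanZ s (a : K) v : kspan s v -> kspan s (a%:MP *: v).
Proof.
elim: s v => [|x s IHs] v /=; first by move=> ->; rewrite scaler0.
by case=> b /IHs sv; exists (a * b); rewrite mpolyCM -scalerA -scalerBr.
Qed.

Lemma kspan_cons x s v : kspan s v -> kspan (x :: s) v.
Proof. by exists 0; rewrite mpolyC0 scale0r subr0. Qed.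

Lemma mem_kspan s v : v \in s -> kspan s v.
Proof.
elim: s => // x s IHs; rewrite inE => /orP[/eqP->|/IHs/kspan_cons//].
by exists 1; rewrite mpolyC1 scale1r subrr; apply: kspan0.
Qed.

Lemma kspan_subset s t v : {subset s <= t} -> kspan s v -> kspan t v.
Proof.
elim: s v => [|x s IHs] v sub /=; first by move=> ->; apply: kspan0.
case=> a sv; rewrite -(subrK (a%:MP *: x) v); apply: kspanD.
  by apply: IHs sv => y sy; apply: sub; rewrite inE sy orbT.
by apply/kspanZ/mem_kspan/sub/mem_head.
Qed.

Lemma kspan_sum (I : eqType) (r : seq I) (P : pred I) (f : I -> V) s :
  (forall i, i \in r -> P i -> kspan s (f i)) ->
  kspan s (\sum_(i <- r | P i) f i).
Proof.
move=> sf; rewrite big_seq_cond.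
by apply: big_ind => [|u v|i /andP[]]; [apply: kspan0|apply: kspanD|apply: sf].
Qed.

Lemma has_dim_ext A B d : (forall v, A v <-> B v) -> has_dim A d -> has_dim B d.
Proof.
move=> AB [b [Ab genb freeb]]; exists b.
by split=> // [i|v /AB/genb]; first apply/AB.
Qed.

Lemma has_dim_nil : has_dim (@kspan K N V [::]) 0.
Proof.
exists (fun=> 0); split=> // [v /= ->|a _ []//].
by exists (fun=> 0); rewrite big_ord0.
Qed.

Lemma has_dim_cons x s d : has_dim (kspan s) d ->
  has_dim (kspan (x :: s)) (d + ~~ `[< kspan s x >]).
Proof.
case: asboolP => [sx|nsx]; last first.
  case=> b [sb genb freeb]; rewrite addn1 /=.
  exists (fun i => if unlift ord0 i is Some k then b k else x); split.
  - move=> i; case: unliftP => [k _|_]; last exact: (mem_kspan (mem_head _ _)).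
    exact: (kspan_cons _ (sb k)).
  - move=> v [a /genb[e ve]].
    exists (fun i => if unlift ord0 i is Some k then e k else a).
    rewrite big_ord_recl unlift_none -[LHS](subrK (a%:MP *: x)) addrC ve.
    by congr (_ + _); apply: eq_bigr => i _; rewrite liftK.
  - move=> a; rewrite big_ord_recl unlift_none => /eqP; rewrite addr_eq0.
    move/eqP=> ax.
    have bs : kspan s (\sum_(i < d) (a (lift ord0 i))%:MP *: b i).
      by apply: kspan_sum => i _ _; apply: kspanZ.
    have a0 : a ord0 = 0.
      (* Otherwise x would be a combination of the basis of the tail. *)
      apply/eqP/negPn/negP => a0; apply: nsx.
      rewrite -[x]scale1r -mpolyC1 -(mulVf a0) mpolyCM -scalerA ax.
      apply: kspanZ; rewrite -scaleN1r -mpolyC1 -mpolyCN.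
      apply: kspanZ; congr kspan: bs.
      by apply: eq_bigr => i _; rewrite liftK.
    move: ax; rewrite a0 mpolyC0 scale0r => /esym/eqP; rewrite oppr_eq0 => /eqP.
    under eq_bigr do rewrite liftK.
    move/(freeb (fun i => a (lift ord0 i))) => af i.
    by case: (unliftP ord0 i) => [k ->|->].
rewrite addn0; apply: has_dim_ext => v; split=> [/kspan_cons//|[a sv]].
by rewrite -(subrK (a%:MP *: x) v); apply: kspanD sv (kspanZ _ _).
Qed.

(** Discarding every vector that is a combination of those with a smaller word
    leaves a basis. *)
Lemma has_dim_words (f : bitseq -> V) (R : seq V) d (ws : seq bitseq) :
  pairwise (fun w w' => ltw w' w) ws -> has_dim (kspan R) d ->
  has_dim (kspan (map f ws ++ R))
    (d + count (fun w0 =>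
       ~~ `[< kspan (map f [seq w <- ws | ltw w w0] ++ R) (f w0) >]) ws).
Proof.
move=> + dR; elim: ws => [|w ws IHws]; first by rewrite addn0.
rewrite pairwise_cons => /andP[lt_w /IHws dimws].
have := has_dim_cons (f w) dimws; congr (has_dim _ _).
rewrite /= ltw_irr -addnA; congr (_ + _)%N; rewrite addnC; congr (_ + _)%N.
  by rewrite (all_filterP lt_w).
apply: eq_in_count => u wsu; rewrite ltw_asym //.
exact: (allP lt_w).
Qed.

End Span.

Lemma kspan_map (K : fieldType) (N N' : nat) (V : lmodType {mpoly K[N]})
    (V' : lmodType {mpoly K[N']}) (f : {additive V -> V'}) (s : seq V) (v : V) :
  (forall (a : K) x, f (a%:MP *: x) = a%:MP *: f x) ->
  kspan s v -> kspan (map f s) (f v).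
Proof.
move=> fZ; elim: s v => [|x s IHs] v /=; first by move=> ->; rewrite raddf0.
by case=> a /IHs sv; exists a; rewrite -fZ -raddfB.
Qed.

(** * Increasing maps and bit words *)

HB.instance Definition _ C m n := [isSub for @mor_fun C m n].
HB.instance Definition _ C m n := [Finite of mor C m n by <:].

Section Morphisms.

Variable C : index_category.

Lemma is_mor_incr m n (f : {ffun 'I_m -> 'I_n}) :
  (forall i j : 'I_m, (i < j)%N -> (f i < f j)%N) -> is_mor C f.
Proof.
move=> incr; case: C => /=.
  by apply/forallP => i; apply/forallP => j; apply/implyP/incr.
apply/injectiveP => i j /(congr1 val) /= fij; apply: val_inj => /=.
by case: (ltngtP i j) => // /incr; rewrite fij ltnn.
Qed.

Definition vals m n (f : mor C m n) : seq nat :=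
  [seq val (f i) | i <- enum 'I_m].

Lemma vals_inj m n : injective (@vals m n).
Proof.
move=> f g /eq_in_map fg; apply: val_inj; apply/ffunP => i.
by apply: val_inj; apply: fg; rewrite mem_enum.
Qed.

Lemma word_mor m n u : size u = n -> count id u = m ->
  exists e : mor C m n,
    vals e = mask u (iota 0 n) /\ forall i j : 'I_m, (i < j)%N -> (e i < e j)%N.
Proof.
move=> su cu; set s := mask u (iota 0 n).
have ss : size s = m by rewrite size_mask ?size_iota.
have lts (i : 'I_m) : (nth 0%N s i < n)%N.
  have /(mem_nth 0%N) : (i < size s)%N by rewrite ss.
  by move/mem_mask; rewrite mem_iota.
have incr (i j : 'I_m) : (i < j)%N -> (nth 0%N s i < nth 0%N s j)%N.
  move=> ij; apply: (sorted_ltn_nth ltn_trans) => //; rewrite ?inE ?ss //.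
  by apply: (sorted_mask ltn_trans); apply: iota_ltn_sorted.
have incr' (i j : 'I_m) : (i < j)%N ->
    ([ffun k => Ordinal (lts k)] i < [ffun k => Ordinal (lts k)] j)%N.
  by rewrite !ffunE; apply: incr.
exists (Mor (is_mor_incr incr')); split=> //.
rewrite /vals; under eq_map do rewrite /= ffunE /=.
rewrite (map_comp (nth 0%N s) val) val_enum_ord -ss map_nth_iota0 //.
by rewrite take_size.
Qed.

(** The factor [f'] is a morphism of either category: an increasing [e] both
    preserves and reflects the order of points. *)
Lemma mor_factor w m n (f : mor C w n) (e : mor C m n) :
  (forall i j : 'I_m, (i < j)%N -> (e i < e j)%N) ->
  (forall i, exists k, f i = e k) -> exists f' : mor C w m, f = mor_comp e f'.
Proof.
move=> incr /fin_all_exists[g fg].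
have gP : is_mor C [ffun i => g i].
  case: C f e incr fg => [] f e incr fg /=; last first.
    by apply/injectiveP => i j; rewrite !ffunE => gij;
       apply: (injectiveP _ (morP f)); rewrite !fg gij.
  apply/forallP => i; apply/forallP => j; apply/implyP => ij; rewrite !ffunE.
  have /forallP/(_ i)/forallP/(_ j)/implyP/(_ ij) := morP f; rewrite !fg.
  apply: contraTT; rewrite -!leqNgt leq_eqVlt => /orP[/eqP/val_inj->//|].
  by move/incr/ltnW.
exists (Mor gP); apply: val_inj; apply/ffunP => i.
by rewrite /= !ffunE fg.
Qed.

Lemma is_mor_lift n (p : 'I_n.+1) : is_mor C [ffun i : 'I_n => lift p i].
Proof.
by apply: is_mor_incr => i j ij; rewrite !ffunE /= /bump; lia.
Qed.

Definition omit n (p : 'I_n.+1) : mor C n n.+1 := Mor (is_mor_lift p).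

(** The zero inserted after the prefix [a] stands for the omitted point
    [size a]. *)
Lemma vals_omit m n (f : mor C m n) (a b : bitseq) :
  size (a ++ b) = n -> vals f = mask (a ++ b) (iota 0 n) ->
  vals (mor_comp (omit (inord (size a))) f) =
  mask (a ++ false :: b) (iota 0 n.+1).
Proof.
rewrite size_cat => sab vf.
have -> : vals (mor_comp (omit (inord (size a))) f) =
    map (bump (size a)) (vals f).
  rewrite /vals -map_comp; apply: eq_map => i.
  by rewrite /= !ffunE /= inordK //; lia.
rewrite vf map_mask -sab -addnS !iotaD map_cat.
rewrite !mask_cat ?size_map ?size_iota //.
rewrite !add0n /=; congr (mask _ _ ++ mask _ _).
  rewrite -[RHS]map_id; apply/eq_in_map => i.
  by rewrite mem_iota /bump; lia.
rewrite -add1n iotaDl; apply/eq_in_map => i.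
by rewrite mem_iota /bump; lia.
Qed.

End Morphisms.

(** * Dimensions of word spans *)

Section WordVectors.

Variables (C : index_category) (K : fieldType) (c : nat) (M : Pmodule C K c).

Lemma actZ m n (f : mor C m n) (a : K) (q : M m) :
  act M f (a%:MP *: q) = a%:MP *: act M f q.
Proof. by rewrite act_semilinear Pmap_const. Qed.

(** The map is recovered from its values rather than built from the word.  The
    default [0] makes [wvec_insert] hold for words with any number of ones. *)
Definition wvec (W : nat) (h : M W) (n : nat) (u : bitseq) : M n :=
  if [pick f : mor C W n | vals f == mask u (iota 0 n)] is Some f
  then act M f h else 0.

Definition wvecs (W : nat) (F : seq (M W)) (n : nat) : seq (M n) :=
  flatten [seq [seq wvec h n u | u <- words n W] | h <- F].

Lemma wvecE W (h : M W) n u (f : mor C W n) :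
  vals f = mask u (iota 0 n) -> wvec h n u = act M f h.
Proof.
move=> vf; rewrite /wvec; case: pickP => [f' /eqP vf'|/(_ f)]; last first.
  by rewrite vf eqxx.
by congr (act _ _ _); apply: vals_inj; rewrite vf vf'.
Qed.

Lemma wvec_insert W (h : M W) n a b : size (a ++ b) = n ->
  wvec h n.+1 (a ++ false :: b) =
  act M (omit C (inord (size a))) (wvec h n (a ++ b)).
Proof.
move=> sab; have [cab|ncab] := eqVneq (count id (a ++ b)) W.
  have [e [ve _]] := word_mor C sab cab.
  by rewrite (wvecE _ ve) (wvecE _ (vals_omit sab ve)) act_comp.
have nvals k u (f : mor C W k) :
    size u = k -> count id u = count id (a ++ b) -> vals f != mask u (iota 0 k).
  move=> su cu; apply: contra_neq ncab => /(congr1 size).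
  by rewrite size_map size_enum_ord size_mask ?size_iota // -cu => <-.
rewrite /wvec; case: pickP => [f /eqP/eqP|_].
  rewrite (negbTE (nvals _ _ _ _ _)) //.
    by rewrite -sab !size_cat /= addnS.
  by rewrite !count_cat.
case: pickP => [f /eqP/eqP|_]; last by rewrite raddf0.
by rewrite (negbTE (nvals _ _ _ _ _)).
Qed.

Lemma wvec_insert_word W (h : M W) n (p : nat) u :
  u \in words n W -> (p <= n)%N ->
  act M (omit C (inord p)) (wvec h n u) =
    wvec h n.+1 (take p u ++ false :: drop p u) /\
  take p u ++ false :: drop p u \in words n.+1 W.
Proof.
rewrite !mem_words => /andP[/eqP su cu] pn.
have st : size (take p u) = p by rewrite size_take_min su; apply/minn_idPl.
split; first by rewrite wvec_insert cat_take_drop ?st.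
rewrite size_cat /= addnS -size_cat cat_take_drop su eqxx /=.
by rewrite count_cat /= add0n -count_cat cat_take_drop.
Qed.

Lemma wvecs_insert W (F : seq (M W)) n (p : nat) : (p <= n)%N ->
  {subset map (act M (omit C (inord p))) (wvecs F n) <= wvecs F n.+1}.
Proof.
move=> pn _ /mapP[_ /flatten_mapP[h Fh /mapP[u nu ->]] ->].
have [-> wu] := wvec_insert_word h nu pn.
by apply/flatten_mapP; exists h => //; apply: map_f.
Qed.

(** The words whose vector depends linearly on smaller ones form an ideal,
    because inserting a zero at a fixed place preserves the order of words and
    comes from one linear map. *)
Lemma evpoly_wvecs W (F : seq (M W)) : exists g : nat -> nat,
  evpoly (fun n => (g n)%:Z) /\ forall n, has_dim (kspan (wvecs F n)) (g n).
Proof.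
elim: F => [|h F [g [evg dimF]]].
  by exists (fun=> 0%N); split=> [|n]; [apply: evpoly0|apply: has_dim_nil].
pose low n u := map (wvec h n) [seq w <- words n W | ltw w u] ++ wvecs F n.
pose bad n u := `[< kspan (low n u) (wvec h n u) >].
have idbad : is_ideal (fun u => bad (size u) u).
  move=> a b; have -> : size (a ++ false :: b) = (size (a ++ b)).+1.
    by rewrite !size_cat /= addnS.
  set n := size (a ++ b) => /asboolP sab; apply/asboolP.
  rewrite wvec_insert //.
  have pn : (size a <= n)%N by rewrite /n size_cat leq_addr.
  move/(kspan_map (f := act M (omit C (inord (size a)))) (@actZ _ _ _)): sab.
  apply: kspan_subset => x; rewrite map_cat !mem_cat => /orP[|Fx]; last first.
    by rewrite (wvecs_insert pn Fx) orbT.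
  case/mapP=> _ /mapP[u + ->] ->; rewrite mem_filter => /andP[ltu nu].
  have [-> wu] := wvec_insert_word h nu pn.
  rewrite map_f // mem_filter wu andbT; apply: ltw_insert.
    move: nu; rewrite mem_words => /andP[/eqP su _].
    by rewrite size_take_min su; apply/minn_idPl.
  by rewrite cat_take_drop.
exists (fun n => g n + cocount (fun u => bad (size u) u) n W)%N; split=> [|n].
  exact: evpolyD evg (evpoly_cocount W idbad).
have := has_dim_words (wvec h n) (pairwise_words n W) (dimF n).
congr (has_dim _ (_ + _)); apply: eq_in_count => u; rewrite mem_words /=.
by case/andP=> /eqP-> _.
Qed.

End WordVectors.

(** * Graded components are spanned by word vectors *)

Section Graded.

Variables (C : index_category) (K : fieldType) (c : nat) (M : Pmodule C K c).
Variable G : grading M.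

Lemma hcompZ n j (a : K) (q : M n) : hcomp G n j q -> hcomp G n j (a%:MP *: q).
Proof.
move=> jq; rewrite -[j]add0r; apply: (hcomp_scale G (d := 0)) jq.
by rewrite -alg_mpolyC rpredZ ?dhomog1.
Qed.

Lemma hcomp_sum (I : Type) n j (r : seq I) (P : pred I) (f : I -> M n) :
  (forall i, P i -> hcomp G n j (f i)) -> hcomp G n j (\sum_(i <- r | P i) f i).
Proof.
by move=> jf; apply: big_ind => // [|u v]; [apply: hcomp0|apply: hcompD].
Qed.

Lemma sum_pred1_uniq (I : eqType) (V : zmodType) (s : seq I) (x : I) (v : V) :
  uniq s -> x \in s -> \sum_(y <- s | y == x) v = v.
Proof.
by move=> us sx; rewrite big_const_seq (count_uniq_mem _ us) sx /= addr0.
Qed.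

(** Subtracting the sum from its own degree [j] part turns the equation into a
    vanishing sum of homogeneous elements of distinct degrees. *)
Lemma hcomp_part n j (t : seq (int * M n)) :
  (forall x, x \in t -> hcomp G n x.1 x.2) ->
  hcomp G n j (\sum_(x <- t) x.2) ->
  \sum_(x <- t) x.2 = \sum_(x <- t | x.1 == j) x.2.
Proof.
move=> ht; set q := \sum_(x <- t) x.2 => hq.
pose h e := \sum_(x <- t | x.1 == e) x.2 - (if e == j then q else 0).
pose s := undup (j :: map fst t).
have js : j \in s by rewrite mem_undup mem_head.
have hh e : hcomp G n e (h e).
  apply: hcompD.
    by rewrite big_seq_cond; apply: hcomp_sum => x /andP[/ht + /eqP<-].
  rewrite -scaleN1r -mpolyC1 -mpolyCN; apply: hcompZ.
  by case: eqP => [->//|_]; apply: hcomp0.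
have /(hcomp_direct G (undup_uniq _) hh)/(_ j js)/eqP : \sum_(e <- s) h e = 0.
  rewrite sumrB -big_mkcond /= sum_pred1_uniq ?undup_uniq //; apply/eqP.
  rewrite subr_eq0 (exchange_big_dep xpredT) //= /q; apply/eqP.
  rewrite big_seq [RHS]big_seq; apply: eq_bigr => x tx.
  under eq_bigl do rewrite eq_sym.
  by rewrite sum_pred1_uniq ?undup_uniq // mem_undup inE map_f ?orbT.
by rewrite /h eqxx subr_eq0 => /eqP.
Qed.

(** The new generators are the homogeneous components of the given ones. *)
Lemma homogeneous_generators : finitely_generated M ->
  exists (I : finType) (w : I -> nat) (e : I -> int) (g : forall i, M (w i)),
    (forall i, hcomp G (w i) (e i) (g i)) /\
    forall N : forall n, M n -> Prop, is_submodule N ->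
      (forall i, N (w i) (g i)) -> forall n q, N n q.
Proof.
case=> r [w [g gen]].
have /fin_all_exists[s /fin_all_exists[h sh]] := fun i => hcomp_span G (g i).
pose T := {i : 'I_r & 'I_(size (s i))}.
pose deg (x : T) := nth 0 (s (tag x)) (nat_of_ord (tagged x)).
exists T, (fun x => w (tag x)), deg, (fun x => h (tag x) (deg x)).
split=> [x|N subN Nh].
  by have [] := sh (tag x).
apply: gen => // i; have [_ ->] := sh i; rewrite (big_nth 0) big_mkord.
apply: big_ind => [|u v|k _]; [exact: submod0|exact: submodD|].
exact: (Nh (Tagged (fun i => 'I_(size (s i))) k)).
Qed.

Definition varprod n (l : seq ('I_c * 'I_n)) : Palg K c n :=
  \prod_(x <- l) xvar K x.1 x.2.

Lemma varprod_homog n (l : seq ('I_c * 'I_n)) : varprod l \is (size l).-homog.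
Proof.
rewrite /varprod; elim: l => [|x l IHl]; first by rewrite big_nil dhomog1.
rewrite big_cons /= -add1n; apply: dhomogM IHl.
by rewrite /xvar dhomogX /= mdeg1.
Qed.

Lemma Pmap_varprod m n (f : mor C m n) (l : seq ('I_c * 'I_m)) :
  Pmap f (varprod l) = varprod [seq (x.1, f x.2) | x <- l].
Proof.
rewrite /varprod big_map; elim: l => [|x l IHl].
  by rewrite !big_nil /Pmap rmorph1.
by rewrite !big_cons -IHl -Pmap_xvar /Pmap rmorphM.
Qed.

Section Generators.

Variables (I : finType) (w : I -> nat) (e : I -> int) (g : forall i, M (w i)).
Hypothesis ge : forall i, hcomp G (w i) (e i) (g i).

Definition term n (d : int) (q : M n) : Prop :=
  exists i (f : mor C (w i) n) (l : seq ('I_c * 'I_n)) (a : K),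
    d = (size l)%:Z + e i /\ q = a%:MP *: (varprod l *: act M f (g i)).

(** The degrees are kept with the terms, so that [hcomp_part] can extract a
    homogeneous component. *)
Definition termsum n (q : M n) : Prop :=
  exists t : seq (int * M n),
    (forall x, x \in t -> term x.1 x.2) /\ q = \sum_(x <- t) x.2.

Lemma term_hcomp n d (q : M n) : term d q -> hcomp G n d q.
Proof.
case=> i [f [l [a [-> ->]]]]; apply/hcompZ/hcomp_scale.
  exact: varprod_homog.
exact: act_hcomp.
Qed.

Lemma termsum0 n : termsum (0 : M n).
Proof. by exists [::]; split=> //; rewrite big_nil. Qed.

Lemma termsumD n (u v : M n) : termsum u -> termsum v -> termsum (u + v).
Proof.
case=> t [tT ->] [t' [tT' ->]]; exists (t ++ t'); rewrite big_cat; split=> // x.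
by rewrite mem_cat => /orP[/tT|/tT'].
Qed.

Lemma termsum_map m n (f : {additive M m -> M n}) (q : M m) :
  (forall d u, term d u -> exists d', term d' (f u)) ->
  termsum q -> termsum (f q).
Proof.
move=> fT [t [tT ->]]; rewrite raddf_sum big_seq.
apply: big_ind => [|u v|x /tT/fT[d Td]]; [exact: termsum0|exact: termsumD|].
exists [:: (d, f x.2)]; rewrite big_seq1; split=> // y.
by rewrite inE => /eqP->.
Qed.

Lemma termsum_act m n (f : mor C m n) (q : M m) :
  termsum q -> termsum (act M f q).
Proof.
apply: termsum_map => d _ [i [f' [l [a [_ ->]]]]].
exists ((size l)%:Z + e i), i, (mor_comp f f'), [seq (x.1, f x.2) | x <- l], a.
by rewrite size_map actZ act_semilinear Pmap_varprod act_comp.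
Qed.

Lemma termsum_const n (a : K) (q : M n) : termsum q -> termsum (a%:MP *: q).
Proof.
apply: (termsum_map (f := *:%R (a%:MP : Palg K c n))).
move=> d _ [i [f [l [b [_ ->]]]]].
exists ((size l)%:Z + e i), i, f, l, (a * b); split=> //.
by rewrite mpolyCM -scalerA.
Qed.

Lemma termsum_var n (i : 'I_c) (k : 'I_n) (q : M n) :
  termsum q -> termsum (xvar K i k *: q).
Proof.
apply: (termsum_map (f := *:%R (xvar K i k))).
move=> d _ [i' [f [l [b [_ ->]]]]].
exists ((size l).+1%:Z + e i'), i', f, ((i, k) :: l), b; split=> //.
by rewrite /= /varprod big_cons !scalerA mulrCA mulrA.
Qed.

Lemma termsumZ n (p : Palg K c n) (q : M n) : termsum q -> termsum (p *: q).
Proof.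
have monom m r : termsum r -> termsum ('X_[m] *: r).
  rewrite mpolyXE_id; elim/big_ind: _ r => [r|x y IHx IHy r /IHy/IHx|i _ r].
  - by rewrite scale1r.
  - by rewrite scalerA.
  move=> Tr; case/mxvec_indexP: i => i k.
  elim: (m _) => [|d IHd]; first by rewrite expr0 scale1r.
  by rewrite exprS -scalerA; apply: termsum_var.
move=> Tq; elim/mpolyind: p => [|a m p _ _ IHp].
  by rewrite scale0r; apply: termsum0.
rewrite scalerDl -mul_mpolyC -scalerA; apply: termsumD IHp.
exact/termsum_const/monom.
Qed.

Lemma termsum_all :
  (forall N : forall n, M n -> Prop, is_submodule N ->
      (forall i, N (w i) (g i)) -> forall n q, N n q) ->
  forall n (q : M n), termsum q.
Proof.
apply; first split.
- exact: termsum0.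
- exact: termsumD.
- exact: termsumZ.
- exact: termsum_act.
move=> i; exists [:: (e i, g i)]; rewrite big_seq1; split=> // x.
rewrite inE => /eqP->; exists i, (mor_id C (w i)), [::], 1 => /=.
by rewrite /varprod big_nil mpolyC1 !scale1r act_id add0r.
Qed.

(** The set [D] is padded with arbitrary points up to size [W], so that all terms
    come from the same module [M W]. *)
Lemma word_cover W n (D : {set 'I_n}) : (#|D| <= W)%N -> (W <= n)%N ->
  exists (u : bitseq) (f : mor C W n),
    [/\ u \in words n W, vals f = mask u (iota 0 n),
        forall i j : 'I_W, (i < j)%N -> (f i < f j)%N &
        forall x, x \in D -> exists k, x = f k].
Proof.
move=> DW Wn; have [A DA cA] : exists2 A : {set 'I_n}, D \subset A & #|A| = W.
  elim: W DW Wn => [|W IHW].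
    by rewrite leqn0 => /eqP D0 _; exists D.
  rewrite leq_eqVlt => /orP[/eqP <-|DW] Wn; first by exists D.
  have [A DA cA] := IHW DW (ltnW Wn).
  have /card_gt0P[x] : (0 < #|~: A|)%N.
    by rewrite cardsCs setCK cA card_ord subn_gt0.
  rewrite inE => xA; exists (x |: A); last by rewrite cardsU1 xA cA.
  by rewrite (subset_trans DA) // subsetUr.
pose u := [seq x \in A | x <- enum 'I_n].
have su : size u = n by rewrite size_map size_enum_ord.
have cu : count id u = W by rewrite count_map -cA cardE -size_filter enumT.
have [f [vf incr]] := word_mor C su cu; exists u, f; split=> //.
  by rewrite mem_words su cu !eqxx.
move=> x /(subsetP DA) xA.
have : val x \in vals f.
  rewrite vf -val_enum_ord -map_mask mem_map; last exact: val_inj.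
  by rewrite /u -filter_mask mem_filter xA mem_enum.
by case/mapP=> k _ /val_inj xk; exists k.
Qed.

Lemma varprod_factor m n (f : mor C m n) (l : seq ('I_c * 'I_n)) :
  (forall x, x \in l -> exists k, x.2 = f k) ->
  exists2 l' : seq ('I_c * 'I_m),
    size l' = size l & varprod l = Pmap f (varprod l').
Proof.
move=> lf; suff [l' ->] : exists l', l = [seq (x.1, f x.2) | x <- l'].
  by exists l'; rewrite ?size_map ?Pmap_varprod.
elim: l lf => [|[i j] l IHl] lf; first by exists [::].
have [k /= jk] := lf _ (mem_head _ _); rewrite {}jk.
have [|l' ->] := IHl; last by exists ((i, k) :: l').
by move=> x lx; apply: lf; rewrite inE lx orbT.
Qed.

Variable j : int.

Let deg i := `|j - e i|%N.

Let W := \max_i (w i + deg i).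

Definition bounded_term
    (x : {i : I & (mor C (w i) W * (deg i).-tuple ('I_c * 'I_W))%type}) :
    M W :=
  varprod (tagged x).2 *: act M (tagged x).1 (g (tag x)).

(** The condition on [j] discards the generators of degree larger than [j], for
    which the absolute value [deg i] has no meaning. *)
Definition bounded_terms : seq (M W) :=
  [seq bounded_term x |
    x <- enum {: {i : I & (mor C (w i) W * (deg i).-tuple ('I_c * 'I_W))%type}}
    & j == (deg (tag x))%:Z + e (tag x)].

(** A generator is moved by a map with at most [w i] points in its image, and
    is multiplied by a product of [deg i] variables: both involve at most [W]
    points of [n], so that the term comes from [M W]. *)
Lemma term_kspan n (q : M n) :
  (W <= n)%N -> term j q -> kspan (wvecs bounded_terms n) q.
Proof.
move=> Wn [i [f [l [a [jl ->]]]]]; apply: kspanZ.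
have dl : deg i = size l by rewrite /deg jl addrK.
have [|u [h [nu vh incr cov]]] :=
    word_cover (W := W)
      (D := [set f k | k : 'I_(w i)] :|: [set x in unzip2 l]) _ Wn.
  rewrite (leq_trans (leq_card_setU _ _)) //.
  apply: leq_trans (leq_bigmax i); apply: leq_add.
    by rewrite (leq_trans (leq_imset_card _ _)) // card_ord.
  by rewrite dl -(size_map snd l) cardsE card_size.
have [|f' ->] := mor_factor (f := f) incr.
  by move=> k; apply: cov; rewrite inE imset_f.
have [|l' sl' ->] := varprod_factor (f := h) (l := l).
  by move=> x lx; apply: cov; rewrite !inE map_f ?orbT.
rewrite act_comp -act_semilinear -(wvecE _ vh); apply: mem_kspan.
apply/flatten_mapP.
exists (varprod l' *: act M f' (g i)); last exact: map_f.
have /eqP sl : size l' == deg i by rewrite sl' dl.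
apply/mapP; exists (Tagged
  (fun i => (mor C (w i) W * (deg i).-tuple ('I_c * 'I_W))%type)
  (f', tcast sl (in_tuple l'))).
  by rewrite mem_filter mem_enum andbT; apply/eqP; rewrite /= dl.
by rewrite /bounded_term /= val_tcast.
Qed.

Lemma wvecs_hcomp n (q : M n) :
  kspan (wvecs bounded_terms n) q -> hcomp G n j q.
Proof.
suff: forall x, x \in wvecs bounded_terms n -> hcomp G n j x.
  elim: (wvecs _ _) q => [|x s IHs] q sj /=; first by move=> ->; apply: hcomp0.
  case=> a sq; rewrite -(subrK (a%:MP *: x) q); apply: hcompD.
    by apply: IHs sq => y sy; apply: sj; rewrite inE sy orbT.
  by apply/hcompZ/sj/mem_head.
move=> _ /flatten_mapP[h Fh /mapP[u _ ->]].
have {}Fh : hcomp G W j h.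
  case/mapP: Fh => -[i [f l]]; rewrite mem_filter => /andP[/eqP-> _ ->] /=.
  apply: hcomp_scale; last exact: act_hcomp.
  by rewrite -[X in X.-homog](size_tuple l) varprod_homog.
by rewrite /wvec; case: pickP => [f _|_]; [apply: act_hcomp|apply: hcomp0].
Qed.

End Generators.

Lemma evpoly_hcomp j : finitely_generated M ->
  exists (n0 : nat) (f : nat -> nat), evpoly (fun n => (f n)%:Z) /\
    forall n, (n0 <= n)%N -> has_dim (hcomp G n j) (f n).
Proof.
case/homogeneous_generators=> I [w [e [g [ge gen]]]].
have [f [evf dimf]] := evpoly_wvecs (bounded_terms e g j).
exists (\max_i (w i + `|j - e i|))%N, f; split=> // n Wn.
apply: has_dim_ext (dimf n) => q; split; first exact: wvecs_hcomp.
move=> jq; have [t [tT qt]] := termsum_all e gen q.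
have tG x : x \in t -> hcomp G n x.1 x.2 by move/tT/(term_hcomp ge).
rewrite qt (hcomp_part (j := j) tG) -?qt //; apply: kspan_sum => x tx /eqP xj.
by apply: term_kspan => //; rewrite -xj; apply: tT.
Qed.

End Graded.

(** * Dimension polynomials *)

(** Dropping zero top coefficients, either nothing remains or the remaining top
    coefficient is positive, as the values are nonnegative. *)
Lemma binsum_lead (d : nat) (a : nat -> int) (f : nat -> nat) (n0 : nat) :
  (forall n, (n0 <= n)%N -> (f n)%:Z = binsum d a n) ->
  (exists n1, forall n, (n1 <= n)%N -> f n = 0%N) \/
  exists2 d', 0 < a d' &
    forall n, (n0 <= n)%N -> (f n)%:Z = binsum d'.+1 a n.
Proof.
elim: d => [|d IHd] fa.
  left; exists n0 => n /fa; rewrite /binsum big_ord0 => /eqP.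
  by rewrite eqz_nat => /eqP.
case: (ltrgt0P (a d)) => ad; first by right; exists d.
  (* a negative leading coefficient would make the values negative *)
  have [|n1 neg] := @binsum_pos d (fun i => - a i); first by rewrite oppr_gt0.
  have := neg _ (leq_maxl n1 n0); rewrite /binsum.
  under eq_bigr do rewrite mulNr.
  by rewrite sumrN oppr_gt0 -[X in X < 0]/(binsum _ _ _) -fa ?leq_maxr.
apply: IHd => n /fa ->.
by rewrite /binsum big_ord_recr /= ad mul0r addr0.
Qed.

Lemma has_dim0 (K : fieldType) (N : nat) (V : lmodType {mpoly K[N]})
    (A : V -> Prop) : has_dim A 0 -> forall v, A v -> v = 0.
Proof. by case=> b [_ genb _] v /genb[a ->]; rewrite big_ord0. Qed.

Theorem theorem5p18 (K : fieldType) (c : nat) (hc : (1 <= c)%N)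
    (C : index_category) (M : Pmodule C K c) (G : grading M)
    (fgM : finitely_generated M) (j : int) :
  (exists (p : {poly rat}) (n0 : nat), forall n : nat, (n0 <= n)%N ->
     exists d : nat, has_dim (hcomp G n j) d /\ d%:R = p.[n%:R])
  /\
  (exists (D : nat) (a : nat -> int),
     [/\ (1 <= D)%N,
         exists n0 : nat, forall n : nat, (n0 <= n)%N ->
           exists d : nat, has_dim (hcomp G n j) d /\
             d%:Z = \sum_(1 <= i < D.+1) a i * ('C(n + i - 1, i - 1))%:Z
       & ~ (exists n0 : nat, forall n : nat, (n0 <= n)%N ->
              forall q : M n, hcomp G n j q -> q = 0) ->
         0 < a D]).
Proof.
have [n0 [f [[d /evdeg_binomial[a [n1 fa]]] dimf]]] := evpoly_hcomp G j fgM.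
split.
  have [p pE] := binsum_poly d a; exists p, (maxn n0 n1) => n.
  rewrite geq_max => /andP[n0n n1n]; exists (f n); split; first exact: dimf.
  by rewrite pE -fa // pmulrn.
have shiftE D b n : \sum_(1 <= i < D.+2) b i.-1 * ('C(n + i - 1, i - 1))%:Z =
    binsum D.+1 b n.
  rewrite big_add1 big_mkord; apply: eq_bigr => i _ /=.
  by rewrite addnS !subn1.
case: (binsum_lead fa) => [[n2 f0]|[D aD fD]].
  exists 1%N, (fun=> 0); split=> // [|nz].
    exists (maxn n0 n2) => n; rewrite geq_max => /andP[n0n n2n].
    exists (f n); split; first exact: dimf.
    by rewrite (shiftE _ (fun=> 0)) /binsum big_ord1 mul0r f0.
  case: nz; exists (maxn n0 n2) => n; rewrite geq_max => /andP[n0n n2n].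
  by apply: has_dim0; rewrite -(f0 _ n2n); apply: dimf.
exists D.+1, (fun i => a i.-1); split=> //.
exists (maxn n0 n1) => n; rewrite geq_max => /andP[n0n n1n].
exists (f n); split; first exact: dimf.
by rewrite shiftE -fD.
Qed.
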